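(* Suppose Assumptions 1 through 9 and 7' through 10' listed in the context hold, together with $D\perp X\mid\alpha^\top X$ and $D\perp X\mid\tilde X$, so that $p(X)=p(\tilde X)=p(\alpha^\top X)$, and suppose $X_1\subsetneq\tilde X=X$ and $X_1\subsetneq\alpha^\top X$. Then for $x_{10}\in\Omega$ the asymptotic variance functions of SCQTE and NCQTE satisfy $$\sigma^{*2}_{scqte}(x_{10})=\sigma^{*2}_{ncqte}(x_{10})+E\left[p(\alpha^\top X)(1-p(\alpha^\top X))\left\{\frac{\Delta m_{1,\tau}}{p(\alpha^\top X)}+\frac{\Delta m_{0,\tau}}{1-p(\alpha^\top X)}\right\}^2\Big|X_1=x_{10}\right],$$ where $\Delta m_{j,\tau}=m_{j,\tau}(X)-m_{j,\tau}(\alpha^\top X)$, $j=0,1$.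
   Context: Setting. Fix $k\ge2$, $1\le l<k$, $\tau\in(0,1)$. $(X_i,Y_i(1),Y_i(0),D_i)$, $i=1,\dots,n$, are i.i.d. copies of $(X,Y(1),Y(0),D)$, where $X\in\mathbb R^k$ are covariates, $D\in\{0,1\}$ is the treatment indicator, $Y(0),Y(1)$ are real potential outcomes. The observed outcome is $Y=DY(1)+(1-D)Y(0)$; $Z=(X,D,Y)$. $X_1\in\mathbb R^l$ and $\tilde X$ are subvectors of $X$. $\alpha$ is a $k\times q$ orthonormal matrix. $p(X)=E(D\mid X)$ is the propensity score. $\Omega$ is the set of interior points of the support of $X_1$. $f$ is the density of $X_1$; $F_j(\cdot\mid x_1)$ and $f_j(\cdot\mid x_1)$ are the conditional distribution function and density of $Y(j)$ given $X_1=x_1$, $j=0,1$. With $\rho_\tau(u)=u(\tau-\mathbb I(u<0))$, $q_{j,\tau}(x_{1})=\arg\min_a E[\rho_\tau(Y(j)-a)\mid X_1=x_{1}]$, with gradient $q'_{j,\tau}$. Set notation. Identify a random vector with the set of its components. $A\subsetneq B$ means all elements of $A$ are elements of $B$ and $A$ has strictly smaller cardinality. Variance functions. $\tilde q_{j,\tau}(X_{1})=q_{j,\tau}(x_{10})+q'_{j,\tau}(x_{10})(X_{1}-x_{10})$; $\eta_{j,\tau}(Y)=\frac{\mathbb I(Y\le\tilde q_{j,\tau}(X_{1}))-\tau}{f_j(q_{j,\tau}(x_{10})\mid x_{10})}$; $m_{j,\tau}(X)=\frac{E[\mathbb I(Y(j)\le\tilde q_{j,\tau}(X_{1}))-\tau\mid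 X]}{f_j(q_{j,\tau}(x_{10})\mid x_{10})}$; $m_{j,\tau}(\alpha^\top X)=\frac{E[\mathbb I(Y(j)\le\tilde q_{j,\tau}(X_{1}))-\tau\mid\alpha^\top X]}{f_j(q_{j,\tau}(x_{10})\mid x_{10})}$; $\psi(p(X),Z)=\frac{D}{p(X)}\eta_{1,\tau}(Y)-\frac{1-D}{1-p(X)}\eta_{0,\tau}(Y)$; $\epsilon=D-p(X)$. Then $$\sigma^{*2}_{ncqte}(x_{10})=E\left[\left(\psi(p(X),Z)-\left\{\frac{m_{1,\tau}(X)}{p(X)}+\frac{m_{0,\tau}(X)}{1-p(X)}\right\}\epsilon\right)^2\Big|X_1=x_{10}\right],$$ $$\sigma^{*2}_{scqte}(x_{10})=E\left[\left(\psi(p(\alpha^\top X),Z)-\left\{\frac{m_{1,\tau}(\alpha^\top X)}{p(\alpha^\top X)}+\frac{m_{0,\tau}(\alpha^\top X)}{1-p(\alpha^\top X)}\right\}\epsilon\right)^2\Big|X_1=x_{10}\right].$$ (Multiplied by $\|K\|_2^2/f(x_{10})$, these are the asymptotic variances of the inverse-propensity-weighted local linear estimators of $q_{1,\tau}(x_{10})-q_{0,\tau}(x_{10})$ in which the propensity score is estimated by kernel regression of $D$ on $X$ (NCQTE; kernel $L$, bandwidth $h_0$), respectively on $\hat\alpha^\top X$ (SCQTE; kernel $H$, bandwidth $h_2$), the local linear step using kernel $K$ and bandwidth $h$.) Kernels. $g:\mathbb R^r\to\mathbb R$ is a kernel of order $s$ if $\int g=1$, $\int u_1^{p_1}\cdots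 u_r^{p_r}g(u)\,du=0$ for all nonnegative integers with $1\le\sum p_i<s$, and this integral is nonzero when $\sum p_i=s$. Assumption 1. (i) $(Y(0),Y(1))\perp D\mid X$. (ii) For some very small $c>0$, $c<p(X)<1-c$. Assumption 2. For any $\tau\in(0,1)$, $j=0,1$, $x_{10}\in\Omega$: (i) $q_{j,\tau}(x_{10})$ is the unique $\tau$th conditional quantile of $Y(j)\mid X_1=x_{10}$; (ii) $q_{j,\tau}(\cdot)$ is $s_1\ge2$ times continuously differentiable; (iii) $F_j(y\mid X_1)$ and $f_j(y\mid X_1)$ are bounded and uniformly continuous in $y$. Assumption 3. (i) The support $\chi$ of $X$ is a Cartesian product of compact intervals; the densities of $X$ and of $(X_1,\alpha^\top X)$ (repeated components listed once) are bounded away from zero and infinity and $s_1\ge2$ times continuously differentiable. (ii) $f$ and $f_j(\cdot\mid X_1)$ are bounded away from zero and infinity and continuously differentiable. Assumption 4. $K:\mathbb R^l\to\mathbb R$ is a kernel of order $s_1$, symmetric around zero, and $s^*$ times continuously differentiable, with $s^*\ge s$ and $s^*\ge s_2$. Assumption 5. As $n\to\infty$: $h\to0$, $nh^l\to\infty$, $nh^{2s_1+l+2}\to0$. Assumption 6 (parametric model, for PCQTE). The estimator $\hat\beta$ of the propensity score model $\pi(X,\beta)$, $\beta\in\Theta\subset\mathbb R^d$, $d<\infty$, satisfies $\sup_{X\in\chi}|\pi(X,\hat\beta)-\pi(X,\beta_0)|=O_p(n^{-1/2})$, where $p(X)=\pi(X,\beta_0)$ for all $X\in\chi$. Assumption 7.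 $L:\mathbb R^k\to\mathbb R$ is a kernel of order $s\ge k+l$, symmetric around zero, with finite support $[-M,M]^k$, and its $(s+1)$th derivative is continuous. The density of $X$ is $s$ times continuously differentiable and bounded away from zero and infinity. Assumption 8. $h_0\to0$ and $\log(n)/(nh_0^{k+s})\to0$. Assumption 9. $h_0^{2s}h^{-2s-l}\to0$ and $nh^{-l}h_0^{2s}\to0$. Assumption 7'. $H:\mathbb R^q\to\mathbb R$ is a kernel of order $s_2$, symmetric around zero, with finite support $[-M,M]^q$, and $s_2\ge q+l$ times continuously differentiable. The density of $\alpha^\top X$ is $s_2$ times continuously differentiable. Assumption 8'. $h_2\to0$ and $\log(n)/(nh_2^{s_2+q})\to0$. Assumption 9'. $h_2^{2s_2}h^{-2s_2-l}\to0$ and $nh^{-l}h_2^{2s_2}\to0$. Assumption 10'. $\hat\alpha$ is a root-$n$ consistent estimator of $\alpha$, and the dimension $q$ is given with $l\le q<k$. *)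

(* Defs.v *)
From HB Require Import structures.
From mathcomp Require Import all_boot all_order all_algebra.
From mathcomp Require Import all_classical all_reals all_analysis.
From mathcomp Require Import measurable_realfun.

Set Implicit Arguments.
Unset Strict Implicit.
Unset Printing Implicit Defensive.

Import Order.TTheory GRing.Theory Num.Theory.
Import numFieldNormedType.Exports.

Local Open Scope classical_set_scope.
Local Open Scope ring_scope.

(* Borel sigma-algebra on matrices, hence on R^n = 'rV[R]_n. *)
HB.instance Definition _ (R : realType) (m n : nat) :=
  @isMeasurable.Build (sigma_display (@open 'M[R]_(m, n))) 'M[R]_(m, n)
    <<s @open 'M[R]_(m, n) >> (@sigma_algebra0 _ setT _)
    (@sigma_algebraC _ _) (@sigma_algebra_bigcup _ setT _).

(* [U] is meant to be open; [f] is [s] times continuously differentiable on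
   [U] when all its iterated partial derivatives up to order [s] exist and are
   continuous on [U]. *)
Fixpoint Ck (R : realType) (n s : nat) (U : set 'rV[R]_n) (f : 'rV[R]_n -> R) :
    Prop :=
  (forall x, U x -> {for x, continuous f}) /\
  match s with
  | 0 => True
  | s'.+1 => forall i : 'I_n,
      (forall x, U x -> derivable f x (delta_mx 0 i)) /\
      Ck s' U (fun x => 'D_(delta_mx 0 i) f x)
  end.

Definition C1_real (R : realType) (U : set R) (f : R -> R) : Prop :=
  forall y, U y -> derivable f y 1 /\ {for y, continuous (derive1 f)}.

Definition unif_cont_on (R : realType) (A : set R) (f : R -> R) : Prop :=
  forall e : R, 0 < e -> exists2 dlt : R, 0 < dlt &
    forall y z, A y -> A z -> `|y - z| < dlt -> `|f y - f z| < e.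

Definition bounded_away (R : realType) (V : Type) (A : set V) (f : V -> R) :
    Prop :=
  exists c C : R, 0 < c /\ forall v, A v -> c <= f v <= C.

(* Integral over R^n with respect to Lebesgue measure, as an iterated integral
   (Tonelli for nonnegative measurable [g], Fubini for integrable [g]). *)
Fixpoint leb_int (R : realType) (n : nat) :
    ('rV[R]_n -> \bar R) -> \bar R :=
  match n return ('rV[R]_n -> \bar R) -> \bar R with
  | 0 => fun g => g 0
  | m.+1 => fun g => (\int[lebesgue_measure]_(x in [set: R])
      leb_int (fun v : 'rV[R]_m => g (row_mx (const_mx x : 'rV[R]_1) v)))%E
  end.

Definition monomial (R : realType) (r : nat) (p : 'I_r -> nat) (u : 'rV[R]_r) :
    R := \prod_(i < r) u 0 i ^+ p i.

(* The second clause makes the moments of order at most [s] exist. *)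
Definition kernel_of_order (R : realType) (r s : nat) (g : 'rV[R]_r -> R) :
    Prop :=
  [/\ leb_int (fun u => (g u)%:E) = 1%E,
      forall p : 'I_r -> nat, (\sum_(i < r) p i <= s)%N ->
        (leb_int (fun u => `|monomial p u * g u|%:E) < +oo)%E,
      forall p : 'I_r -> nat, (1 <= \sum_(i < r) p i < s)%N ->
        leb_int (fun u => (monomial p u * g u)%:E) = 0%E
    & forall p : 'I_r -> nat, (\sum_(i < r) p i)%N = s ->
        leb_int (fun u => (monomial p u * g u)%:E) <> 0%E].

Definition symmetric_kernel (R : realType) (r : nat) (g : 'rV[R]_r -> R) :
    Prop := forall u, g (- u) = g u.

Definition cube_supported (R : realType) (r : nat) (g : 'rV[R]_r -> R) :
    Prop :=
  exists2 M : R, 0 < M & forall u : 'rV[R]_r, (exists i, M < `|u 0 i|) -> g u = 0.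

Definition support (R : realType) (d : measure_display) (T : measurableType d)
    (V : topologicalType) (Q : probability T R) (W : T -> V) : set V :=
  [set v | forall B, open_nbhs v B -> (0 < Q (W @^-1` B))%E].

Definition has_density (R : realType) (d : measure_display)
    (T : measurableType d) (n : nat) (Q : probability T R)
    (W : T -> 'rV[R]_n) (f : 'rV[R]_n -> R) : Prop :=
  [/\ measurable_fun [set: 'rV[R]_n] f, forall x, 0 <= f x
    & forall B : set 'rV[R]_n, measurable B ->
        Q (W @^-1` B) = leb_int (fun x => (\1_B x * f x)%:E)].

Definition has_density_real (R : realType) (d : measure_display)
    (T : measurableType d) (Q : probability T R) (W : T -> R) (f : R -> R) :
    Prop :=
  [/\ measurable_fun [set: R] f, forall y, 0 <= f y
    & forall B : set R, measurable B ->
        Q (W @^-1` B) = (\int[lebesgue_measure]_(y in B) (f y)%:E)%E].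

Definition Ck_density (R : realType) (d : measure_display)
    (T : measurableType d) (n : nat) (Q : probability T R)
    (W : T -> 'rV[R]_n) (s : nat) : Prop :=
  exists2 f, has_density Q W f & Ck s (support Q W)° f.

(* Smoothness is on the interior of the support: a density bounded away from
   zero on its support jumps at the boundary. *)
Definition regular_density (R : realType) (d : measure_display)
    (T : measurableType d) (n : nat) (Q : probability T R)
    (W : T -> 'rV[R]_n) (s : nat) : Prop :=
  exists f, [/\ has_density Q W f, bounded_away (support Q W) f
              & Ck s (support Q W)° f].

(* [g] is a version of v |-> E_Q[V | W = v]. *)
Definition cond_exp (R : realType) (d d' : measure_display)
    (T : measurableType d) (U : measurableType d') (Q : probability T R)
    (V : T -> R) (W : T -> U) (g : U -> R) : Prop :=
  [/\ measurable_fun [set: U] g,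
      Q.-integrable [set: T] (fun t => (V t)%:E),
      Q.-integrable [set: T] (fun t => (g (W t))%:E)
    & forall B, measurable B ->
        (\int[Q]_(t in W @^-1` B) (V t)%:E =
         \int[Q]_(t in W @^-1` B) (g (W t))%:E)%E].

(* A _||_ B | W under Q: versions of the conditional probabilities given W of
   the events [A in SA] and [B in SB] multiply to a version of the conditional
   probability of their intersection. *)
Definition cond_indep (R : realType) (d d1 d2 d3 : measure_display)
    (T : measurableType d) (U1 : measurableType d1) (U2 : measurableType d2)
    (U3 : measurableType d3) (Q : probability T R)
    (A : T -> U1) (B : T -> U2) (W : T -> U3) : Prop :=
  forall SA SB, measurable SA -> measurable SB ->
  exists gA gB,
    [/\ cond_exp Q \1_(A @^-1` SA) W gA, cond_exp Q \1_(B @^-1` SB) W gB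
      & cond_exp Q \1_((A @^-1` SA) `&` (B @^-1` SB)) W
          (fun w => gA w * gB w)].

(* [kappa] is a regular conditional probability of [P] given [W], proper at
   the points of [S]: kappa w = P(. | W = w). *)
Definition regular_cond (R : realType) (d d' : measure_display)
    (T : measurableType d) (U : measurableType d') (P : probability T R)
    (W : T -> U) (S : set U) (kappa : U -> probability T R) : Prop :=
  [/\ forall A, measurable A ->
        measurable_fun [set: U] (kappa ^~ A),
      forall A B, measurable A -> measurable B ->
        P (A `&` W @^-1` B) = (\int[P]_(t in W @^-1` B) kappa (W t) A)%E
    & forall w, S w -> kappa w (W @^-1` [set w]) = 1%E].

Definition comps (R : realType) (T : Type) (n : nat) (W : T -> 'rV[R]_n) :
    set (T -> R) :=
  [set (fun t => W t 0 i) | i in [set: 'I_n]].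

Definition strict_sub (R : realType) (T : Type) (m n : nat)
    (V : T -> 'rV[R]_m) (W : T -> 'rV[R]_n) : Prop :=
  comps V `<=` comps W /\ ~~ (comps W #<= comps V)%card.

Definition subvec (R : realType) (T : Type) (k m : nat) (ix : 'I_m -> 'I_k)
    (W : T -> 'rV[R]_k) (t : T) : 'rV[R]_m :=
  \row_i W t 0 (ix i).

Definition check_loss (R : realType) (tau u : R) : R :=
  u * (tau - (u < 0)%R%:R).

Definition is_quantile (R : realType) (d : measure_display)
    (T : measurableType d) (Q : probability T R) (W : T -> R) (tau a : R) :
    Prop :=
  (Q [set t | (W t < a)%R] <= tau%:E)%E /\
  (tau%:E <= Q [set t | (W t <= a)%R])%E.

(* [potY M true], [potY M false] are Y(1), Y(0); [covX M], [treat M] are X, D;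
   [ix1 M], [ixt M] select X_1 and tilde X in X; [condP M x1] is
   P(. | X_1 = x1); [qtl M j tau x1] is q_{j,tau}(x1) and [fY M j y x1] is
   f_j(y | x1). *)
Record cqte_model (R : realType) (d : measure_display) (T : measurableType d)
    (k l kt q : nat) := CqteModel {
  Pr : probability T R;
  covX : T -> 'rV[R]_k;
  potY : bool -> T -> R;
  treat : T -> bool;
  ix1 : 'I_l -> 'I_k;
  ixt : 'I_kt -> 'I_k;
  alpha : 'M[R]_(k, q);
  condP : 'rV[R]_l -> probability T R;
  qtl : bool -> R -> 'rV[R]_l -> R;
  fY : bool -> R -> 'rV[R]_l -> R
}.

Section Model.
Context (R : realType) (d : measure_display) (T : measurableType d)
  (k l kt q : nat) (M : cqte_model R T k l kt q).

Definition covX1 : T -> 'rV[R]_l := subvec (ix1 M) (covX M).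
Definition covXt : T -> 'rV[R]_kt := subvec (ixt M) (covX M).
(* alpha^T X, written as a row vector *)
Definition alphaX (t : T) : 'rV[R]_q := covX M t *m alpha M.

Definition Dr (t : T) : R := (treat M t)%:R.
Definition obsY (t : T) : R :=
  Dr t * potY M true t + (1 - Dr t) * potY M false t.

Definition Omega : set 'rV[R]_l := (support (Pr M) covX1)°.
Definition chi : set 'rV[R]_k := support (Pr M) (covX M).

Definition FY (j : bool) (y : R) (x1 : 'rV[R]_l) : R :=
  fine (condP M x1 [set t | potY M j t <= y]).

(* A conditional statement given X_1 = x1, and further conditioning inside the
   slice X_1 = x1, only makes sense once versions are fixed. All conditioning
   vectors below contain X_1, so conditional statements are read under the
   joint law and, compatibly, under each P(. | X_1 = x1), x1 in Omega (by the
   tower property, the first already gives the second for almost every x1). *)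
Definition coherently (Phi : probability T R -> Prop) : Prop :=
  Phi (Pr M) /\ forall x1, Omega x1 -> Phi (condP M x1).

Definition condE (d' : measure_display) (U : measurableType d') (V : T -> R)
    (W : T -> U) (g : U -> R) : Prop :=
  coherently (fun Q => cond_exp Q V W g).

Definition CI (d1 d2 d3 : measure_display) (U1 : measurableType d1)
    (U2 : measurableType d2) (U3 : measurableType d3)
    (A : T -> U1) (B : T -> U2) (W : T -> U3) : Prop :=
  coherently (fun Q => cond_indep Q A B W).

Definition model_ok : Prop :=
  [/\ [/\ measurable_fun [set: T] (covX M),
          forall j, measurable_fun [set: T] (potY M j)
        & measurable_fun [set: T] (treat M)],
      [/\ injective (ix1 M), injective (ixt M)
        & (alpha M)^T *m alpha M = 1%:M],
      regular_cond (Pr M) covX1 Omega (condP M),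
      (* q_{j,tau}(x1) is in the argmin; the expectations may be infinite *)
      forall j tau x1, 0 < tau < 1 -> Omega x1 -> forall a : R,
        ('E_(condP M x1)[fun t => check_loss tau
                                    (potY M j t - qtl M j tau x1)] <=
         'E_(condP M x1)[fun t => check_loss tau (potY M j t - a)])%E
    & forall j x1, Omega x1 ->
        has_density_real (condP M x1) (potY M j) (fun y => fY M j y x1)].

Definition unconfounded : Prop :=
  CI (fun t => (potY M false t, potY M true t)) (treat M) (covX M).

Definition overlap (p : 'rV[R]_k -> R) : Prop :=
  exists2 c : R, 0 < c &
    coherently (fun Q => {ae Q, forall t, c < p (covX M t) < 1 - c}).

(* f_j(. | x1) cannot be both uniformly continuous on the whole line and
   bounded away from zero on its support, so its regularity is on the support
   of Y(j) given X_1 = x1. *)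
Definition quantile_regular (s1 : nat) : Prop :=
  forall (tau : R) (j : bool), 0 < tau < 1 ->
  [/\ forall x10, Omega x10 -> forall a,
        is_quantile (condP M x10) (potY M j) tau a <-> a = qtl M j tau x10,
      (2 <= s1)%N /\ Ck s1 Omega (qtl M j tau)
    & forall x10, Omega x10 ->
        let S := support (condP M x10) (potY M j) in
        [/\ exists C : R, forall y, `|FY j y x10| <= C,
            unif_cont_on [set: R] (fun y => FY j y x10),
            exists C : R, forall y, S y -> `|fY M j y x10| <= C
          & unif_cont_on S (fun y => fY M j y x10)]].

Definition covariates_regular (s1 : nat) : Prop :=
  [/\ exists a b : 'I_k -> R,
        chi = [set x : 'rV[R]_k | forall i, a i <= x 0 i <= b i],
      (2 <= s1)%N,
      regular_density (Pr M) (covX M) s1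
    & (* any listing, without repetition, of the components of
         (X_1, alpha^T X) *)
      forall (r : nat) (V : T -> 'rV[R]_r),
        injective (fun (i : 'I_r) (t : T) => V t 0 i) ->
        comps V = comps covX1 `|` comps alphaX ->
        regular_density (Pr M) V s1].

Definition densities_regular : Prop :=
  regular_density (Pr M) covX1 1 /\
  forall j x1, Omega x1 ->
    let S := support (condP M x1) (potY M j) in
    bounded_away S (fun y => fY M j y x1) /\
    C1_real S° (fun y => fY M j y x1).

Section Variance.
Context (tau : R) (x10 : 'rV[R]_l).

Definition qtilde (j : bool) (t : T) : R :=
  qtl M j tau x10 +
  \sum_(i < l) 'D_(delta_mx 0 i) (qtl M j tau) x10 * (covX1 t 0 i - x10 0 i).

Definition fq (j : bool) : R := fY M j (qtl M j tau x10) x10.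

Definition eta (j : bool) (t : T) : R :=
  ((obsY t <= qtilde j t)%R%:R - tau) / fq j.

(* numerator of m_{j,tau} before conditioning *)
Definition check_score (j : bool) (t : T) : R :=
  (potY M j t <= qtilde j t)%R%:R - tau.

Definition psi (pr : R) (t : T) : R :=
  Dr t / pr * eta true t - (1 - Dr t) / (1 - pr) * eta false t.

(* E[(psi(pi(W), Z) - {m_1(W) / pi(W) + m_0(W) / (1 - pi(W))} epsilon)^2
   | X_1 = x10], with epsilon = D - p(X). *)
Definition sigma2 (n : nat) (p : 'rV[R]_k -> R) (W : T -> 'rV[R]_n)
    (pi : 'rV[R]_n -> R) (m : bool -> 'rV[R]_n -> R) : \bar R :=
  'E_(condP M x10)[fun t =>
    (psi (pi (W t)) t -
     (m true (W t) / pi (W t) + m false (W t) / (1 - pi (W t))) *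
     (Dr t - p (covX M t))) ^+ 2].

End Variance.

End Model.

Section Sampling.
Context (R : realType) (d : measure_display) (T : measurableType d)
  (k l kt q : nat) (M : cqte_model R T k l kt q).

(* From (X, Y(1), Y(0), D) to Z = (X, D, Y). *)
Definition obs_of (w : 'rV[R]_k * R * R * bool) : 'rV[R]_k * bool * R :=
  let: (x, y1, y0, b) := w in (x, b, b%:R * y1 + (1 - b%:R) * y0).

Definition iid_copies (S : nat -> T -> 'rV[R]_k * R * R * bool) : Prop :=
  [/\ forall i, measurable_fun [set: T] (S i),
      forall i B, measurable B ->
        Pr M (S i @^-1` B) =
        Pr M [set t | B (covX M t, potY M true t, potY M false t, treat M t)]
    & forall (n : nat) (B : nat -> set ('rV[R]_k * R * R * bool)),
        (forall i, measurable (B i)) ->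
        Pr M (\bigcap_(i in [set i | (i < n)%N]) (S i @^-1` B i)) =
        (\prod_(i < n) Pr M (S i @^-1` B i))%E].

Definition sample_Z (S : nat -> T -> 'rV[R]_k * R * R * bool) (n : nat)
    (t : T) : n.-tuple ('rV[R]_k * bool * R) :=
  [tuple obs_of (S i t) | i < n].

(* A_n = O_p(r_n); the A_n need not be measurable *)
Definition big_Op (A : nat -> T -> \bar R) (r : nat -> R) : Prop :=
  forall e : R, 0 < e -> exists2 C : R, 0 < C &
    \forall n \near \oo, exists E : set T,
      [/\ measurable E, ((1 - e)%:E <= Pr M E)%E
        & forall t, E t -> (A n t <= (C * r n)%:E)%E].

Definition parametric_propensity (p : 'rV[R]_k -> R)
    (S : nat -> T -> 'rV[R]_k * R * R * bool) (dim : nat)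
    (Theta : set 'rV[R]_dim) (pi : 'rV[R]_k -> 'rV[R]_dim -> R)
    (beta0 : 'rV[R]_dim)
    (betahat : forall n, n.-tuple ('rV[R]_k * bool * R) -> 'rV[R]_dim) :
    Prop :=
  [/\ Theta beta0,
      forall n, measurable_fun setT (betahat n) /\ forall z, Theta (betahat n z),
      forall x, chi M x -> p x = pi x beta0
    & big_Op (fun n t => ereal_sup
          [set `|pi x (betahat n (sample_Z S n t)) - pi x beta0|%:E
             | x in chi M])
        (fun n => (Num.sqrt n%:R)^-1)].

Definition root_n_consistent
    (S : nat -> T -> 'rV[R]_k * R * R * bool)
    (alphahat : forall n, n.-tuple ('rV[R]_k * bool * R) -> 'M[R]_(k, q)) :
    Prop :=
  (forall n, measurable_fun setT (alphahat n)) /\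
  big_Op (fun n t => `|alphahat n (sample_Z S n t) - alpha M|%:E)
    (fun n => (Num.sqrt n%:R)^-1).

Definition outcome_kernel (K : 'rV[R]_l -> R) (s1 sstar s s2 : nat) : Prop :=
  [/\ kernel_of_order s1 K, symmetric_kernel K, Ck sstar setT K
    & (s <= sstar)%N /\ (s2 <= sstar)%N].

Definition outcome_bandwidth (h : nat -> R) (s1 : nat) : Prop :=
  [/\ forall n, 0 < h n, h n @[n --> \oo] --> (0 : R),
      n%:R * h n ^+ l @[n --> \oo] --> +oo
    & n%:R * h n ^+ (2 * s1 + l + 2) @[n --> \oo] --> (0 : R)].

Definition nonparametric_kernel (L : 'rV[R]_k -> R) (s : nat) : Prop :=
  [/\ kernel_of_order s L /\ (k + l <= s)%N, symmetric_kernel L,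
      cube_supported L, Ck s.+1 setT L
    & regular_density (Pr M) (covX M) s].

Definition alphaX_kernel (H : 'rV[R]_q -> R) (s2 : nat) : Prop :=
  [/\ kernel_of_order s2 H, symmetric_kernel H, cube_supported H,
      (q + l <= s2)%N /\ Ck s2 setT H
    & Ck_density (Pr M) (alphaX M) s2].

(* [b] is the bandwidth of a propensity score estimate using a kernel of order
   [s] on R^r; [h] below is the bandwidth of the local linear step on R^l. *)
Definition ps_bandwidth (b : nat -> R) (r s : nat) : Prop :=
  [/\ forall n, 0 < b n, b n @[n --> \oo] --> (0 : R)
    & ln n%:R / (n%:R * b n ^+ (r + s)) @[n --> \oo] --> (0 : R)].

Definition relative_bandwidth (b h : nat -> R) (s : nat) : Prop :=
  b n ^+ (2 * s) * h n ^- (2 * s + l) @[n --> \oo] --> (0 : R) /\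
  n%:R * h n ^- l * b n ^+ (2 * s) @[n --> \oo] --> (0 : R).

End Sampling.

(* Main.v *)
Require Import Defs.
From HB Require Import structures.
From mathcomp Require Import all_boot all_order all_algebra.
From mathcomp Require Import all_classical all_reals all_analysis.
From mathcomp Require Import measurable_realfun.
From mathcomp Require Import ring lra.

Set Implicit Arguments.
Unset Strict Implicit.
Unset Printing Implicit Defensive.

Import Order.TTheory GRing.Theory Num.Theory.
Import numFieldNormedType.Exports.
Import HBNNSimple.

Local Open Scope classical_set_scope.
Local Open Scope ring_scope.

(** Everything happens under the conditional law Q of the data given
    X_1 = x10. Both variances are second moments of the same influence
    function, evaluated once with the regressions m_j(X) and once with
    m_j(alpha^T X). Sufficiency of alpha^T X for D makes the two propensity
    scores agree almost surely ([cond_indep_sufficient]), so the two influence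
    functions differ only by G (D - p(X)), where
      G = Delta m_1 / p + Delta m_0 / (1 - p)
    is a function of X. Squaring produces the cross term 2 A G (D - p), with A
    the influence function built on m_j(X), and the square G^2 (D - p)^2. Given
    X the first has mean zero, because A is the efficient influence function
    and is uncorrelated with D - p within the levels of X, and the second has
    mean G^2 p (1 - p), which is the extra term of the statement.

    Rather than computing conditional expectations of products, the proof works
    with variables U that are centered given X: the integral of U over every
    event of the form X in B vanishes. With S_j the rescaled scores
    (I(Y(j) <= q) - tau) / f_j, the variables
      D - p,   S_j - m_j,   D S_j - p m_j
    are centered given X; for the last one this is unconfoundedness
    ([centered_score_treat]). A polynomial identity, valid because D is 0 or 1
    ([influence_sqr]), writes the square of the coarse influence function as
    the square of the fine one, plus p (1 - p) G^2, plus a combination of these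
    centered variables whose coefficients are functions of X. Centered
    variables stay centered after multiplication by functions of X, provided
    the product is integrable ([centeredM]), so the combination integrates to
    zero.

    Unconfoundedness concerns events in (Y(0), Y(1)) alone, whereas the scores
    compare Y(j) with a line in X_1. Under Q, however, X_1 equals x10 almost
    surely ([covX1_condP]), and the line reduces to the constant q_j(x10). *)

(** * Essentially bounded statistics *)

(** The formula x^-1 = x (x^2)^(-1), valid also at 0, reduces inversion to a
    power function, whose measurability is known. *)
Lemma measurable_funV (R : realType) (d : measure_display)
    (T : measurableType d) (f : T -> R) :
  measurable_fun [set: T] f -> measurable_fun [set: T] (fun t => (f t)^-1).
Proof.
move=> mf; have -> : (fun t => (f t)^-1) = (fun t => f t * (f t ^+ 2) `^ (-1)).
  apply/funext => t; rewrite powR_inv1 ?sqr_ge0//.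
  have [->|f0] := eqVneq (f t) 0; first by rewrite invr0 mul0r.
  by rewrite expr2 invfM mulrA mulfV// mul1r.
apply: measurable_funM => //; apply: (measurableT_comp (measurable_powR (-1))).
exact: measurable_funX.
Qed.

(** The bound is imposed on f only along W, so that the same algebra of functions
    serves for random variables (W = id) and for functions of a covariate. *)
Definition ess_bounded (R : realType) (d d' : measure_display)
    (T : measurableType d) (U : measurableType d') (Q : probability T R)
    (W : T -> U) (f : U -> R) : Prop :=
  measurable_fun [set: U] f /\ exists C : R, \forall t \ae Q, `|f (W t)| <= C.

Section EssBounded.
Context (R : realType) (d d' : measure_display) (T : measurableType d)
  (U : measurableType d') (Q : probability T R) (W : T -> U).
Implicit Types f g : U -> R.

Lemma ess_bounded_comp f : measurable_fun [set: T] W ->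
  ess_bounded Q W f -> ess_bounded Q id (fun t => f (W t)).
Proof. by move=> mW [mf fC]; split=> //; exact: measurableT_comp. Qed.

Lemma ess_bounded_cst c : ess_bounded Q W (cst c).
Proof. by split=> //; exists `|c|; apply: nearW. Qed.

Lemma ess_boundedD f g :
  ess_bounded Q W f -> ess_bounded Q W g -> ess_bounded Q W (fun u => f u + g u).
Proof.
move=> [mf [C fC]] [mg [D gD]]; split; first exact: measurable_funD.
exists (C + D); apply: filterS2 fC gD => t ft gt.
by rewrite (le_trans (ler_normD _ _))// lerD.
Qed.

Lemma ess_boundedN f : ess_bounded Q W f -> ess_bounded Q W (fun u => - f u).
Proof.
move=> [mf [C fC]]; split; first exact: measurableT_comp.
by exists C; apply: filterS fC => t; rewrite normrN.
Qed.

Lemma ess_boundedB f g :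
  ess_bounded Q W f -> ess_bounded Q W g -> ess_bounded Q W (fun u => f u - g u).
Proof. by move=> fB /ess_boundedN; exact: ess_boundedD. Qed.

Lemma ess_boundedM f g :
  ess_bounded Q W f -> ess_bounded Q W g -> ess_bounded Q W (fun u => f u * g u).
Proof.
move=> [mf [C fC]] [mg [D gD]]; split; first exact: measurable_funM.
exists (C * D); apply: filterS2 fC gD => t ft gt.
by rewrite normrM ler_pM.
Qed.

Lemma ess_boundedV (c : R) f : 0 < c -> measurable_fun [set: U] f ->
  (\forall t \ae Q, c < f (W t)) -> ess_bounded Q W (fun u => (f u)^-1).
Proof.
move=> c0 mf fc; split; first exact: measurable_funV.
exists c^-1; apply: filterS fc => t ct.
have f0 : 0 < f (W t) by exact: lt_trans ct.
by rewrite gtr0_norm ?invr_gt0// lef_pV2 ?posrE// ltW.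
Qed.

Lemma ess_boundedX2 f : ess_bounded Q W f -> ess_bounded Q W (fun u => f u ^+ 2).
Proof. by under eq_fun do rewrite expr2; move=> fb; exact: ess_boundedM. Qed.

End EssBounded.

Lemma ess_bounded_integrable (R : realType) (d : measure_display)
    (T : measurableType d) (Q : probability T R) (f : T -> R) :
  ess_bounded Q id f -> Q.-integrable [set: T] (EFin \o f).
Proof.
move=> [mf [C fC]]; apply/integrableP; split; first exact/measurable_EFinP.
have C_fin : (\int[Q]_t (EFin \o cst `|C|%R) t < +oo)%E.
  exact/integrable_lty/finite_measure_integrable_cst.
apply: le_lt_trans C_fin; apply: ae_ge0_le_integral => //.
- by apply: measurableT_comp => //; exact/measurable_EFinP.
- by move=> t _; rewrite /= lee_fin.
- exact/measurable_EFinP.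
- by apply: filterS fC => t ft _; rewrite /= lee_fin (le_trans ft)// ler_norm.
Qed.

Lemma indic_le1 (R : realType) (T : Type) (E : set T) (t : T) : `|\1_E t| <= 1 :> R.
Proof. by rewrite indicE; case: (_ \in _); rewrite ?normr1 ?normr0. Qed.

Lemma ess_bounded_indic (R : realType) (d : measure_display)
    (T : measurableType d) (Q : probability T R) (E : set T) :
  measurable E -> ess_bounded Q id (\1_E : T -> R).
Proof.
move=> mE; split; first exact: measurable_indic.
by exists 1; apply: nearW => t; exact: indic_le1.
Qed.

(** * Variables centered given a statistic *)

(** This is E[X | W] = 0 almost surely, without choosing a version of the
    conditional expectation. *)
Definition centered (R : realType) (d d' : measure_display)
    (T : measurableType d) (U : measurableType d') (Q : probability T R)
    (W : T -> U) (X : T -> R) : Prop :=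
  Q.-integrable [set: T] (EFin \o X) /\
  forall B, measurable B -> (\int[Q]_(t in W @^-1` B) (X t)%:E = 0)%E.

Section Centered.
Context (R : realType) (d d' : measure_display) (T : measurableType d)
  (U : measurableType d') (Q : probability T R) (W : T -> U)
  (mW : measurable_fun [set: T] W).
Implicit Types (X Y : T -> R) (phi : U -> R) (B : set U).

Let mWI B : measurable B -> measurable (W @^-1` B).
Proof. by move=> mB; rewrite -[_ @^-1` _]setTI; exact: mW. Qed.

Let integrable_preimage X B : measurable B ->
  Q.-integrable [set: T] (EFin \o X) -> Q.-integrable (W @^-1` B) (EFin \o X).
Proof. by move=> mB; apply: integrableS => //; exact: mWI. Qed.

Lemma centered_integral X : centered Q W X -> (\int[Q]_t (X t)%:E = 0)%E.
Proof. by move=> [_ /(_ setT)]; rewrite preimage_setT; exact. Qed.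

Lemma centered_ae X Y : measurable_fun [set: T] Y ->
  (\forall t \ae Q, X t = Y t) -> centered Q W X -> centered Q W Y.
Proof.
move=> mY XY [iX X0]; have mX := measurable_int _ iX.
have mYE : measurable_fun [set: T] (EFin \o Y) by exact/measurable_EFinP.
split.
  apply/integrableP; split => //; have [_] := integrableP _ _ _ iX.
  apply: le_lt_trans; apply: ae_ge0_le_integral => //.
  - exact: measurableT_comp.
  - exact: measurableT_comp.
  - by apply: filterS XY => t /= ->.
move=> B mB; rewrite -(X0 B mB); apply: ae_eq_integral; first exact: mWI.
- exact: measurable_funS mYE.
- exact: measurable_funS mX.
- by apply: filterS XY => t /= ->.
Qed.

Lemma centeredD X Y : centered Q W X -> centered Q W Y ->
  centered Q W (fun t => X t + Y t).
Proof.
move=> [iX X0] [iY Y0]; split; first exact: (integrableD measurableT iX iY).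
move=> B mB; rewrite [LHS](integralD_EFin (mWI mB)); last 2 first.
- exact: integrable_preimage.
- exact: integrable_preimage.
by rewrite X0// Y0// adde0.
Qed.

Lemma centeredZ k X : centered Q W X -> centered Q W (fun t => k * X t).
Proof.
move=> [iX X0]; split; first exact: (integrableZl measurableT k iX).
move=> B mB; under eq_integral do rewrite EFinM.
by rewrite (integralZl (mWI mB) (integrable_preimage mB iX)) X0// mule0.
Qed.

Lemma centeredB X Y : centered Q W X -> centered Q W Y ->
  centered Q W (fun t => X t - Y t).
Proof.
move=> X0 /(centeredZ (-1)) Y0; have := centeredD X0 Y0.
by under eq_fun do rewrite mulN1r.
Qed.

Lemma centered_sum (I : eqType) (s : seq I) (X : I -> T -> R) :
  (forall i, i \in s -> centered Q W (X i)) ->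
  centered Q W (fun t => \sum_(i <- s) X i t).
Proof.
elim: s => [|i s IHs] Xs.
  under eq_fun do rewrite big_nil; split; first exact: integrable0.
  by move=> B mB; rewrite integral0_eq.
under eq_fun do rewrite big_cons; apply: centeredD; first exact/Xs/mem_head.
by apply: IHs => j js; apply: Xs; rewrite inE js orbT.
Qed.

Lemma centered_indic X B : measurable B -> centered Q W X ->
  centered Q W (fun t => \1_B (W t) * X t).
Proof.
move=> mB [iX X0].
have E : (fun t => (\1_B (W t) * X t)%:E) = (EFin \o X) \_ (W @^-1` B).
  apply/funext => t; rewrite patchE indicE.
  have -> : (t \in W @^-1` B) = (W t \in B) by apply/idP/idP; rewrite !inE.
  by case: ifP => _; rewrite ?mul1r ?mul0r.
split; first by rewrite /comp E; apply/integrable_restrict; rewrite ?setTI//;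
  [exact: mWI|exact: integrable_preimage].
move=> B' mB'; rewrite E -integral_mkcondr -preimage_setI.
by apply: X0; exact: measurableI.
Qed.

Lemma centered_simple X (phi : {nnsfun U >-> R}) :
  centered Q W X -> centered Q W (fun t => phi (W t) * X t).
Proof.
move=> X0; under eq_fun => t.
  rewrite fimfunE fsbig_finite//= mulr_suml; under eq_bigr do rewrite -mulrA.
  over.
by apply: centered_sum => y _; apply: centeredZ; exact: centered_indic.
Qed.

(** For phi >= 0, the simple functions increasing to phi give centered products,
    and |phi(W) X| dominates them all. *)
Let centeredM_ge0 X phi : measurable_fun [set: U] phi ->
  (forall w, 0 <= phi w) -> centered Q W X ->
  Q.-integrable [set: T] (fun t => (phi (W t) * X t)%:E) ->
  centered Q W (fun t => phi (W t) * X t).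
Proof.
move=> mphi phi0 X0 iphiX; split=> // B mB.
have mE : measurable_fun [set: U] (EFin \o phi) by exact/measurable_EFinP.
have phi0E w : [set: U] w -> (0 <= (EFin \o phi) w)%E by rewrite lee_fin.
pose phi_ := nnsfun_approx measurableT mE.
have phi_phi w n : phi_ n w <= phi w.
  by rewrite -lee_fin /phi_ nnsfun_approxE; exact: (le_approx n phi0E).
have phi_X n : centered Q W (fun t => phi_ n (W t) * X t).
  exact: centered_simple.
have [] := @dominated_convergence _ _ _ Q (W @^-1` B) (mWI mB)
  (fun n t => (phi_ n (W t) * X t)%:E) (fun t => (phi (W t) * X t)%:E)
  (fun t => `|phi (W t) * X t|%:E).
- by move=> n; apply: measurable_funTS; have [/measurable_int] := phi_X n.
- by apply: measurable_funTS; exact: measurable_int iphiX.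
- apply: nearW => t _; apply: cvg_EFin; first exact: nearW.
  apply: cvgM; last exact: cvg_cst.
  by have /fine_cvgP[_] := cvg_nnsfun_approx measurableT mE phi0E (I : setT (W t)).
- exact/integrable_preimage/integrable_norm.
- apply: nearW => t n _; rewrite lee_fin !normrM ler_wpM2r//.
  by rewrite !ger0_norm.
move=> _ _; under eq_fun do rewrite (phi_X _).2//.
by move=> /cvg_lim <- //; rewrite lim_cst.
Qed.

(** The factor known given W is pulled out of the conditional expectation. *)
Lemma centeredM X phi : measurable_fun [set: U] phi -> centered Q W X ->
  Q.-integrable [set: T] (fun t => (phi (W t) * X t)%:E) ->
  centered Q W (fun t => phi (W t) * X t).
Proof.
move=> mphi X0 iphiX.
have part (psi : U -> R) : measurable_fun [set: U] psi ->
    (forall w, 0 <= psi w <= `|phi w|) ->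
    centered Q W (fun t => psi (W t) * X t).
  move=> mpsi psi_phi; apply: centeredM_ge0 => //.
    by move=> w; case/andP: (psi_phi w).
  apply: le_integrable iphiX => //.
    apply/measurable_EFinP/measurable_funM; first exact: measurableT_comp.
    by apply/measurable_EFinP; have [/measurable_int] := X0.
  move=> t _; have /andP[psi0 psi_le] := psi_phi (W t).
  by rewrite lee_fin !normrM ler_wpM2r// ger0_norm.
have -> : (fun t => phi (W t) * X t) =
    (fun t => Num.max (phi (W t)) 0 * X t - Num.max (- phi (W t)) 0 * X t).
  apply/funext => t; rewrite -mulrBl; congr (_ * _).
  by rewrite /Num.max; case: ltgtP => ?; case: ltP => ?; lra.
apply: centeredB; [apply: (part (fun w => Num.max (phi w) 0))
                  |apply: (part (fun w => Num.max (- phi w) 0))].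
- exact: measurable_maxr.
- by move=> w; rewrite le_max lexx orbT/= ge_max ler_norm normr_ge0.
- by apply: measurable_maxr => //; exact: measurableT_comp.
- by move=> w; rewrite le_max lexx orbT/= ge_max -normrN ler_norm normr_ge0.
Qed.

Lemma centered_ge0_eq0 X : centered Q W X -> (\forall t \ae Q, 0 <= X t) ->
  \forall t \ae Q, X t = 0.
Proof.
move=> X0 X_ge0; have [iX _] := X0; have mX := measurable_int _ iX.
have : (\int[Q]_t `|(X t)%:E| = 0)%E.
  rewrite -(centered_integral X0); apply: ae_eq_integral => //.
  - exact: measurableT_comp.
  - by apply: filterS X_ge0 => t X_ge0 _; rewrite /= ger0_norm.
move=> /(ae_eq_integral_abs Q measurableT mX).
by apply: filterS => t /(_ I) [].
Qed.

Let sgn_le1 (x : R) : `|x / `|x| | <= 1.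
Proof.
by rewrite normrM normfV normr_id; have [->|x0] := eqVneq x 0;
  rewrite ?normr0 ?mul0r// divff ?normr_eq0.
Qed.

Let sgnK (x : R) : x / `|x| * x = `|x|.
Proof.
have [->|x0] := eqVneq x 0; first by rewrite normr0 mulr0.
by rewrite mulrAC -expr2 -real_normK ?num_real// expr2 mulfK// normr_eq0.
Qed.

Let integrable_bdd_comp X phi : measurable_fun [set: U] phi ->
  (forall w, `|phi w| <= 1) -> Q.-integrable [set: T] (EFin \o X) ->
  Q.-integrable [set: T] (fun t => (phi (W t) * X t)%:E).
Proof.
move=> mphi phi1 iX; apply: (le_integrable _ _ _ iX) => //.
  apply/measurable_EFinP/measurable_funM; first exact: measurableT_comp.
  by apply/measurable_EFinP; exact: measurable_int iX.
by move=> t _; rewrite lee_fin normrM ler_piMl.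
Qed.

(** Multiplying phi(W) by its sign, itself a function of W, shows that |phi(W)|
    is centered; being nonnegative, it vanishes. *)
Lemma centered_comp_eq0 phi : measurable_fun [set: U] phi ->
  centered Q W (phi \o W) -> \forall t \ae Q, phi (W t) = 0.
Proof.
move=> mphi phi0; have [iphi _] := phi0.
have msgn : measurable_fun [set: U] (fun w => phi w / `|phi w|).
  by apply: measurable_funM => //; apply: measurable_funV; exact: measurableT_comp.
have norm0 : centered Q W (fun t => `|phi (W t)|).
  have := centeredM msgn phi0 (integrable_bdd_comp msgn (fun=> sgn_le1 _) iphi).
  by congr centered; apply/funext => t; exact: sgnK.
apply: filterS (centered_ge0_eq0 norm0 (nearW _ (fun t => normr_ge0 _))) => t.
by move/eqP; rewrite normr_eq0 => /eqP.
Qed.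

(** A conditional expectation inherits the bounds of the variable: on the event
    |g(W)| > C, the sign of g(W) times g(W) - X is positive, yet it has mean
    zero, so that event is null. *)
Lemma centered_bounded X (g : U -> R) (C : R) : measurable_fun [set: U] g ->
  (forall t, `|X t| <= C) -> centered Q W (fun t => X t - g (W t)) ->
  \forall t \ae Q, `|g (W t)| <= C.
Proof.
move=> mg XC Xg; have [iXg _] := Xg.
pose B := [set w | C < `|g w|].
have mB : measurable B.
  rewrite -[B]setTI; apply: (measurable_fun_ltr (f := cst C)) => //.
  exact: measurableT_comp.
pose sg w : R := \1_B w * (g w / `|g w|).
have msg : measurable_fun [set: U] sg.
  apply: measurable_funM => //; apply: measurable_funM => //.
  by apply: measurable_funV; exact: measurableT_comp.
have sg1 w : `|sg w| <= 1.
  rewrite normrM indicE; case: (_ \in _); rewrite ?normr0 ?mul0r//.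
  by rewrite normr1 mul1r.
have := centeredZ (-1) (centeredM msg Xg (integrable_bdd_comp msg sg1 iXg)).
have sgE t : -1 * (sg (W t) * (X t - g (W t))) =
    \1_B (W t) * (`|g (W t)| - g (W t) / `|g (W t)| * X t).
  by rewrite /sg mulN1r -mulrN opprB -[LHS]mulrA; congr (_ * _); rewrite mulrBr sgnK.
have ge0 t : B (W t) -> 0 < `|g (W t)| - g (W t) / `|g (W t)| * X t.
  move=> Bt; rewrite subr_gt0 (le_lt_trans _ Bt)// (le_trans (ler_norm _))//.
  by rewrite normrM (le_trans _ (XC t))// ler_piMl.
move=> /centered_ge0_eq0 h; apply: filterS (h _) => [t|].
  rewrite sgE leNgt => Bt0; apply/negP => Bt.
  by have := ge0 t Bt; move: Bt0; rewrite indicE mem_set// mul1r => ->;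
    rewrite ltxx.
apply: nearW => t; rewrite sgE indicE; case: (boolP (_ \in _)) => [|_].
  by rewrite inE => Bt; rewrite mul1r ltW// ge0.
by rewrite mul0r.
Qed.

End Centered.

(** * Conditional expectation and conditional independence *)

Section CondExp.
Context (R : realType) (d d' : measure_display) (T : measurableType d)
  (U : measurableType d') (Q : probability T R) (W : T -> U)
  (mW : measurable_fun [set: T] W).
Implicit Types (X : T -> R) (g : U -> R).

Lemma cond_exp_centered X g :
  cond_exp Q X W g -> centered Q W (fun t => X t - g (W t)).
Proof.
move=> [mg iX ig Xg]; split; first exact: (integrableB measurableT iX ig).
move=> B mB; have mWB : measurable (W @^-1` B) by rewrite -[_ @^-1` _]setTI; exact: mW.
have iXB := integrableS measurableT mWB (@subsetT _ _) iX.
have igB := integrableS measurableT mWB (@subsetT _ _) ig.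
rewrite [LHS](integralB_EFin mWB iXB igB) [X in (X - _)%E](Xg B mB) subee//.
exact: integrable_fin_num.
Qed.

Lemma cond_exp_ess_bounded X g (C : R) : (forall t, `|X t| <= C) ->
  cond_exp Q X W g -> ess_bounded Q W g.
Proof.
move=> XC Xg; have [mg _ _ _] := Xg; split=> //.
by exists C; exact: centered_bounded mg XC (cond_exp_centered Xg).
Qed.

Lemma centered_unique X g1 g2 :
  measurable_fun [set: U] g1 -> measurable_fun [set: U] g2 ->
  centered Q W (fun t => X t - g1 (W t)) ->
  centered Q W (fun t => X t - g2 (W t)) -> \forall t \ae Q, g1 (W t) = g2 (W t).
Proof.
move=> mg1 mg2 Xg1 Xg2.
have : centered Q W ((fun w => g2 w - g1 w) \o W).
  have := centeredB mW Xg1 Xg2; congr centered; apply/funext => t /=; ring.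
move=> /(centered_comp_eq0 mW (measurable_funB mg2 mg1)).
by apply: filterS => t /eqP; rewrite subr_eq0 => /eqP.
Qed.

Lemma centeredM_bounded X g : measurable_fun [set: U] g ->
  ess_bounded Q id X -> ess_bounded Q W g -> centered Q W X ->
  centered Q W (fun t => g (W t) * X t).
Proof.
move=> mg Xb gb X0; apply: centeredM => //.
apply: ess_bounded_integrable; apply: ess_boundedM => //.
exact: ess_bounded_comp.
Qed.

End CondExp.

Section CondIndep.
Context (R : realType) (d d1 d2 d3 : measure_display) (T : measurableType d)
  (U1 : measurableType d1) (U2 : measurableType d2) (U3 : measurableType d3)
  (Q : probability T R) (A : T -> U1) (B : T -> U2) (W : T -> U3)
  (mA : measurable_fun [set: T] A) (mB : measurable_fun [set: T] B)
  (mW : measurable_fun [set: T] W).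

(** Conditional independence provides a factorization for some versions of the
    conditional probabilities; by uniqueness it holds with any prescribed
    version a of the first one. *)
Lemma cond_indep_indic (SA : set U1) (SB : set U2) (a : U3 -> R) :
  measurable SA -> measurable SB -> cond_indep Q A B W ->
  cond_exp Q \1_(A @^-1` SA) W a ->
  exists2 b : U3 -> R, cond_exp Q \1_(B @^-1` SB) W b &
  centered Q W (fun t => \1_(A @^-1` SA) t * \1_(B @^-1` SB) t
                         - a (W t) * b (W t)).
Proof.
move=> mSA mSB AB aE; have [gA [gB [gAE gBE gABE]]] := AB _ _ mSA mSB.
exists gB => //; have [ma _ _ _] := aE; have [mgA _ _ _] := gAE.
have [mgB _ _ _] := gBE.
have a_gA := centered_unique mW ma mgA
  (cond_exp_centered mW aE) (cond_exp_centered mW gAE).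
apply: centered_ae (cond_exp_centered mW gABE) => //; last first.
  by apply: filterS a_gA => t ->; rewrite indicI.
have [|mAS _] := @ess_bounded_indic _ _ _ Q (A @^-1` SA).
  by rewrite -[_ @^-1` _]setTI; exact: mA.
have [|mBS _] := @ess_bounded_indic _ _ _ Q (B @^-1` SB).
  by rewrite -[_ @^-1` _]setTI; exact: mB.
apply: measurable_funB; first exact: measurable_funM.
by apply: measurable_funM; exact: measurableT_comp.
Qed.

(** When W is a function of B, this says that W is sufficient: the probability of
    an event in A given W is also its probability given B. For an event IB in B
    with probability b given W, both IA IB and a(W) IB have conditional
    expectation a(W) b(W) given W, hence the same mean. *)
Lemma cond_indep_sufficient (SA : set U1) (a : U3 -> R) :
  measurable SA -> cond_indep Q A B W ->
  cond_exp Q \1_(A @^-1` SA) W a ->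
  centered Q B (fun t => \1_(A @^-1` SA) t - a (W t)).
Proof.
move=> mSA AB aE; have [iX _] := cond_exp_centered mW aE; split=> // SB mSB.
have [b bE abE] := cond_indep_indic mSA mSB AB aE.
have [ma _ _ _] := aE; have [mb _ _ _] := bE.
have mBS : measurable (B @^-1` SB) by rewrite -[_ @^-1` _]setTI; exact: mB.
have aB := cond_exp_ess_bounded mW (indic_le1 _ _) aE.
have bB := cond_exp_ess_bounded mW (indic_le1 _ _) bE.
have IBb := ess_boundedB (ess_bounded_indic Q mBS) (ess_bounded_comp mW bB).
have bc := centeredM_bounded mW ma IBb aB (cond_exp_centered mW bE).
rewrite -(centered_integral (centeredB mW abE bc)) integral_mkcond.
apply: eq_integral => t _; rewrite patchE [\1_(B @^-1` SB) t]indicE.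
by case: ifPn => _ /=; rewrite -?[point]/(0%:E); congr (_%:E); ring.
Qed.

End CondIndep.

(** * Borel maps between matrix spaces *)

Section MatrixMeasurable.
Context (R : realType).

Lemma continuous_mx (V : topologicalType) m n (f : V -> 'M[R]_(m, n)) :
  (forall i j, continuous (fun x => f x i j)) -> continuous f.
Proof.
move=> fij x A [P PA sPA].
have fP : \forall y \near x, forall i j, P i j (f y i j).
  apply: filter_forall => i; apply: filter_forall => j.
  exact: fij (P i j) (PA i j).
by apply: filterS fP => y Py; exact: sPA.
Qed.

Lemma continuous_measurable_mx m n m' n' (f : 'M[R]_(m, n) -> 'M[R]_(m', n')) :
  continuous f -> measurable_fun [set: 'M[R]_(m, n)] f.
Proof.
move=> cf; apply: (measurability (@open 'M[R]_(m', n')) erefl) => _ [B oB <-].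
rewrite setTI; by apply: sub_sigma_algebra; move/continuousP: cf; apply.
Qed.

Lemma measurable_mulmxr k n (A : 'M[R]_(k, n)) :
  measurable_fun [set: 'rV[R]_k] (fun x => x *m A).
Proof.
apply: continuous_measurable_mx; apply: continuous_mx => i j.
under eq_fun do rewrite mxE; apply: continuous_big; first exact: add_continuous.
move=> l _ x; apply: (@continuousM _ _ (fun y : 'rV[R]_k => y i l) (cst (A l j))).
  exact: coord_continuous.
exact: cst_continuous.
Qed.

Lemma measurable_colsub k l (ix : 'I_l -> 'I_k) :
  measurable_fun [set: 'rV[R]_k] (fun x => \row_i x 0 (ix i)).
Proof.
apply: continuous_measurable_mx; apply: continuous_mx => i j x.
under eq_fun do rewrite mxE.
exact: coord_continuous.
Qed.

(** The complement of a point is the union, over the entries, of the open sets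
    where that entry differs. *)
Lemma measurable_set1_mx m n (x : 'M[R]_(m, n)) : measurable [set x].
Proof.
have -> : [set x] = ~` \bigcup_(ij in [set: 'I_m * 'I_n])
    ((fun y : 'M[R]_(m, n) => y ij.1 ij.2) @^-1` [set~ x ij.1 ij.2]).
  apply/seteqP; split=> [y -> [ij _] []//|y /= nxy]; apply/matrixP => i j.
  by apply: contrapT => xyij; apply: nxy; exists (i, j).
apply: measurableC; apply: sub_sigma_algebra; apply: bigcup_open => ij _.
apply: open_comp; first by move=> y _; exact: coord_continuous.
have -> : [set~ x ij.1 ij.2] = [set y | y != x ij.1 ij.2]; last exact: open_neq.
by apply/seteqP; split=> y /= /eqP.
Qed.

End MatrixMeasurable.

(** * Second moments of the influence function *)

(** The influence function of the inverse-propensity-weighted contrast: s holds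
    the scores of the two potential outcomes and m their regressions. The
    weights use the propensity pr and the residual of D uses e; the two are
    kept apart because in the coarse variance they are different versions of
    the propensity score. *)
Definition influence (R : realType) (pr e : R) (D : bool) (s m : bool -> R) : R :=
  D%:R / pr * s true - (1 - D%:R) / (1 - pr) * s false -
  (m true / pr + m false / (1 - pr)) * (D%:R - e).

(** The influence functions built on a and m differ by G (D - p). In the cross
    term and in the square, D^2 = D gives
    (D - p)^2 = p (1 - p) + (1 - 2 p) (D - p), and the weighted scores become
    multiples of D s_1 and (1 - D) s_0; replacing these by their regressions
    p m_1 and (1 - p) m_0 cancels everything except the displayed remainders. *)
Lemma influence_sqr (R : realType) (p : R) (D : bool) (s m a : bool -> R) :
  p != 0 -> 1 - p != 0 ->
  let G := (m true - a true) / p + (m false - a false) / (1 - p) in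
  influence p p D s a ^+ 2 =
  influence p p D s m ^+ 2 + p * (1 - p) * G ^+ 2 +
  (2 * G * (1 - p) / p * (D%:R * s true - p * m true) +
   2 * G * p / (1 - p) *
     ((s false - m false) - (D%:R * s false - p * m false)) +
   G * (1 - 2 * p) * (G - 2 * (m true / p + m false / (1 - p))) * (D%:R - p)).
Proof. by move=> p0 p1; rewrite /influence; case: D => /=; field; rewrite p1 p0. Qed.

Ltac ess_bdd := repeat first
  [ assumption | exact: ess_bounded_cst | apply: ess_boundedX2
  | apply: ess_boundedM | apply: ess_boundedB | apply: ess_boundedD
  | apply: ess_boundedN ].

Section VarianceDecomposition.
Context (R : realType) (d d' : measure_display) (T : measurableType d)
  (U : measurableType d') (Q : probability T R) (X : T -> U)
  (mX : measurable_fun [set: T] X) (D : T -> bool) (s : bool -> T -> R)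
  (p pa : U -> R) (m a : bool -> U -> R) (c : R).

(** The identity of [influence_sqr] is integrated. Overlap bounds every factor
    essentially, so all the integrals are finite, and the remainder is centered
    given X. *)
Lemma variance_decomposition :
  0 < c -> measurable_fun [set: U] p -> measurable_fun [set: U] pa ->
  (\forall t \ae Q, c < p (X t) < 1 - c) ->
  (\forall t \ae Q, p (X t) = pa (X t)) ->
  ess_bounded Q id (fun t => (D t)%:R : R) ->
  (forall j, ess_bounded Q id (s j)) ->
  (forall j, ess_bounded Q X (m j)) -> (forall j, ess_bounded Q X (a j)) ->
  centered Q X (fun t => (D t)%:R - p (X t)) ->
  (forall j, centered Q X (fun t => s j t - m j (X t))) ->
  (forall j, centered Q X (fun t => (D t)%:R * s j t - p (X t) * m j (X t))) ->
  ('E_Q[fun t => (influence (pa (X t)) (p (X t)) (D t)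
                    (s ^~ t) (a ^~ (X t)) ^+ 2)%R] =
   'E_Q[fun t => (influence (p (X t)) (p (X t)) (D t)
                    (s ^~ t) (m ^~ (X t)) ^+ 2)%R] +
   'E_Q[fun t => (pa (X t) * (1 - pa (X t)) *
      ((m true (X t) - a true (X t)) / pa (X t) +
       (m false (X t) - a false (X t)) / (1 - pa (X t))) ^+ 2)%R])%E.
Proof.
move=> c0 mp mpa p_bd p_pa Db sb mb ab Dp sm Dsm.
have pb : ess_bounded Q X p.
  split=> //; exists 1; apply: filterS p_bd => t /andP[cp p1].
  by rewrite ger0_norm; lra.
have pab : ess_bounded Q X pa.
  have [_ [C pC]] := pb; split=> //; exists C.
  by apply: filterS2 p_pa pC => t ->.
have pVb : ess_bounded Q X (fun u => (p u)^-1).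
  by apply: (ess_boundedV c0) => //; apply: filterS p_bd => t /andP[].
have qVb : ess_bounded Q X (fun u => (1 - p u)^-1).
  apply: (ess_boundedV c0); first exact: measurable_funB.
  by apply: filterS p_bd => t /andP[_]; lra.
have paVb : ess_bounded Q X (fun u => (pa u)^-1).
  apply: (ess_boundedV c0) => //.
  by apply: filterS2 p_bd p_pa => t /andP[? _] <-.
have qaVb : ess_bounded Q X (fun u => (1 - pa u)^-1).
  apply: (ess_boundedV c0); first exact: measurable_funB.
  by apply: filterS2 p_bd p_pa => t /andP[_ ?] <-; lra.
have [[[m1b m0b] a1b] a0b] := (mb true, mb false, ab true, ab false).
have [s1b s0b] := (sb true, sb false).
have XT := fun f => @ess_bounded_comp _ _ _ _ _ Q X f mX.
have [[[pbT pabT] pVbT] qVbT] := (XT _ pb, XT _ pab, XT _ pVb, XT _ qVb).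
have [paVbT qaVbT] := (XT _ paVb, XT _ qaVb).
have [[[m1bT m0bT] a1bT] a0bT] := (XT _ m1b, XT _ m0b, XT _ a1b, XT _ a0b).
pose G u := (m true u - a true u) / p u + (m false u - a false u) / (1 - p u).
pose An t := influence (p (X t)) (p (X t)) (D t) (s ^~ t) (m ^~ (X t)).
pose As t := influence (pa (X t)) (p (X t)) (D t) (s ^~ t) (a ^~ (X t)).
pose gap t := pa (X t) * (1 - pa (X t)) *
      ((m true (X t) - a true (X t)) / pa (X t) +
       (m false (X t) - a false (X t)) / (1 - pa (X t))) ^+ 2.
have Gb : ess_bounded Q X G by rewrite /G; ess_bdd.
have Anb : ess_bounded Q id (fun t => An t ^+ 2) by rewrite /An /influence; ess_bdd.
have Asb : ess_bounded Q id (fun t => As t ^+ 2) by rewrite /As /influence; ess_bdd.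
have gapb : ess_bounded Q id gap by rewrite /gap; ess_bdd.
(* The coefficients of the centered variables in the squared identity. *)
pose phi1 u := 2 * G u * (1 - p u) / p u.
pose phi0 u := 2 * G u * p u / (1 - p u).
pose phiD u := G u * (1 - 2 * p u) *
  (G u - 2 * (m true u / p u + m false u / (1 - p u))).
have phi1b : ess_bounded Q X phi1 by rewrite /phi1; ess_bdd.
have phi0b : ess_bounded Q X phi0 by rewrite /phi0; ess_bdd.
have phiDb : ess_bounded Q X phiD by rewrite /phiD; ess_bdd.
have c1 : centered Q X (fun t => phi1 (X t) *
    ((D t)%:R * s true t - p (X t) * m true (X t))).
  by apply: centeredM_bounded => //; [exact: phi1b.1|ess_bdd].
have c2 : centered Q X (fun t => phi0 (X t) * (s false t - m false (X t) -
    ((D t)%:R * s false t - p (X t) * m false (X t)))).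
  by apply: centeredM_bounded => //; [exact: phi0b.1|ess_bdd|exact: centeredB].
have c3 : centered Q X (fun t => phiD (X t) * ((D t)%:R - p (X t))).
  by apply: centeredM_bounded => //; [exact: phiDb.1|ess_bdd].
have cR := centeredD mX (centeredD mX c1 c2) c3.
have iAg := ess_bounded_integrable (ess_boundedD Anb gapb).
rewrite unlock -integralD_EFin//; [|exact: ess_bounded_integrable..].
rewrite -[RHS]adde0 -(centered_integral cR) -[RHS]integralD_EFin//; last exact: cR.1.
apply: ae_eq_integral => //.
- by apply/measurable_EFinP; exact: Asb.1.
- apply: emeasurable_funD; first exact: measurable_int iAg.
  exact: measurable_int cR.1.
- apply: filterS2 p_bd p_pa => t /andP[cp p1] p_eq _ /=.
  have p0 : p (X t) != 0 by rewrite gt_eqF//; lra.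
  have q0 : 1 - p (X t) != 0 by rewrite gt_eqF//; lra.
  by rewrite -p_eq (influence_sqr (D t) (s ^~ t) (m ^~ (X t)) (a ^~ (X t)) p0 q0) -EFinD.
Qed.

End VarianceDecomposition.

(** * The conditional quantile model *)

Lemma measurable_true : measurable [set true].
Proof. by []. Qed.

Lemma indic_treated (R : numDomainType) (T : Type) (D : T -> bool) :
  \1_(D @^-1` [set true]) = (fun t => (D t)%:R) :> (T -> R).
Proof.
apply/funext => t; rewrite indicE; case: (boolP (D t)) => Dt.
  by rewrite mem_set.
by rewrite memNset//= => Dt1; rewrite Dt1 in Dt.
Qed.

(** Unconfoundedness: given X, the score s, an indicator of an event in Y up to a
    constant, and the treatment D are uncorrelated. *)
Lemma centered_score_treat (R : realType) (d d1 d2 : measure_display)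
    (T : measurableType d) (U1 : measurableType d1) (U2 : measurableType d2)
    (Q : probability T R) (Y : T -> U1) (D : T -> bool) (X : T -> U2)
    (A : set U1) (tau : R) (s : T -> R) (p e : U2 -> R) :
  measurable_fun [set: T] Y -> measurable_fun [set: T] D ->
  measurable_fun [set: T] X -> measurable A -> cond_indep Q Y D X ->
  (\forall t \ae Q, s t = \1_(Y @^-1` A) t - tau) ->
  cond_exp Q s X e -> cond_exp Q (fun t => (D t)%:R) X p ->
  centered Q X (fun t => (D t)%:R * s t - p (X t) * e (X t)).
Proof.
move=> mY mD mX mA YD sE se Dp; have [a [_ [aE _ _]]] := YD A setT mA measurableT.
have [b bE abE] := cond_indep_indic mY mD mX mA measurable_true YD aE.
rewrite indic_treated in bE abE.
have [[ma _ _ _] [mb _ _ _]] := (aE, bE).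
have [[me is_ _ _] [mp iD _ _]] := (se, Dp).
have ms : measurable_fun [set: T] s by exact/measurable_EFinP/(measurable_int _ is_).
have mDr : measurable_fun [set: T] (fun t => (D t)%:R : R).
  exact/measurable_EFinP/(measurable_int _ iD).
have b_p := centered_unique mX mb mp (cond_exp_centered mX bE) (cond_exp_centered mX Dp).
have a_e : \forall t \ae Q, a (X t) - tau = e (X t).
  apply: (centered_unique (g1 := fun u => a u - tau) mX _ me _ (cond_exp_centered mX se)).
    exact: measurable_funB.
  apply: centered_ae (cond_exp_centered mX aE) => //.
    apply: measurable_funB => //; apply: measurable_funB => //.
    exact: measurableT_comp.
  by apply: filterS sE => t ->; ring.
apply: centered_ae (centeredB mX abE (centeredZ mX tau (cond_exp_centered mX Dp))) => //.
  by apply: measurable_funB; apply: measurable_funM => //; exact: measurableT_comp.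
apply: filterS3 sE b_p a_e => t -> -> <-; ring.
Qed.

(** On D = 1 the observed outcome is Y(1), and on D = 0 it is Y(0), so the scores
    of the observed outcome may be replaced by those of the potential
    outcomes. *)
Lemma sigma2_influence (R : realType) (d : measure_display)
    (T : measurableType d) (k l kt q n : nat) (M : cqte_model R T k l kt q)
    (tau : R) (x10 : 'rV[R]_l) (p : 'rV[R]_k -> R) (W : T -> 'rV[R]_n)
    (pi : 'rV[R]_n -> R) (m : bool -> 'rV[R]_n -> R) :
  sigma2 M tau x10 p W pi m =
  ('E_(condP M x10)[fun t => (influence (pi (W t)) (p (covX M t)) (treat M t)
     (fun j => check_score M tau x10 j t / fq M tau x10 j)
     (m ^~ (W t)) ^+ 2)%R])%E.
Proof.
congr ('E_(condP M x10)[_])%E; apply/funext => t; congr (_ ^+ 2).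
rewrite /psi /influence /Defs.eta /check_score /obsY /Dr; case: (treat M t) => /=.
  by rewrite subrr !(mul0r, mul1r) addr0.
by rewrite subr0 !(mul0r, mul1r, add0r).
Qed.

Lemma covX1_condP (R : realType) (d : measure_display)
    (T : measurableType d) (k l kt q : nat) (M : cqte_model R T k l kt q)
    (x10 : 'rV[R]_l) : model_ok M -> Omega M x10 ->
  \forall t \ae condP M x10, covX1 M t = x10.
Proof.
move=> [[mX _ _] _ [_ _ proper] _ _] x10_Omega.
have mX1 : measurable (covX1 M @^-1` [set x10]).
  have mcovX1 : measurable_fun [set: T] (covX1 M).
    exact: measurableT_comp (measurable_colsub (ix1 M)) mX.
  by rewrite -[_ @^-1` _]setTI; apply: mcovX1 => //; exact: measurable_set1_mx.
exists (~` (covX1 M @^-1` [set x10])); split => //; first exact: measurableC.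
by rewrite probability_setC// proper// subee.
Qed.

Theorem corollary2p4 (R : realType) (d : measure_display)
  (T : measurableType d) (k l kt q : nat) (M : cqte_model R T k l kt q)
  (tau : R) (s s1 s2 sstar : nat)
  (S : nat -> T -> 'rV[R]_k * R * R * bool)
  (dim : nat) (Theta : set 'rV[R]_dim) (pi : 'rV[R]_k -> 'rV[R]_dim -> R)
  (beta0 : 'rV[R]_dim)
  (betahat : forall n, n.-tuple ('rV[R]_k * bool * R) -> 'rV[R]_dim)
  (alphahat : forall n, n.-tuple ('rV[R]_k * bool * R) -> 'M[R]_(k, q))
  (K : 'rV[R]_l -> R) (L : 'rV[R]_k -> R) (H : 'rV[R]_q -> R)
  (h h0 h2 : nat -> R)
  (* p(X) = E(D | X) and p(alpha^T X) = E(D | alpha^T X) *)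
  (p : 'rV[R]_k -> R) (pa : 'rV[R]_q -> R)
  (k_ge2 : (2 <= k)%N) (l_ge1 : (1 <= l)%N) (l_lt_k : (l < k)%N)
  (tau01 : 0 < tau < 1)
  (M_ok : model_ok M) (iid : iid_copies M S)
  (pE : condE M (Dr M) (covX M) p) (paE : condE M (Dr M) (alphaX M) pa)
  (A1i : unconfounded M) (A1ii : overlap M p)
  (A2 : quantile_regular M s1)
  (A3i : covariates_regular M s1) (A3ii : densities_regular M)
  (A4 : outcome_kernel K s1 sstar s s2)
  (A5 : outcome_bandwidth l h s1)
  (A6 : parametric_propensity M p S Theta pi beta0 betahat)
  (A7 : nonparametric_kernel M L s)
  (A8 : ps_bandwidth h0 k s)
  (A9 : relative_bandwidth l h0 h s)
  (A7' : alphaX_kernel M H s2)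
  (A8' : ps_bandwidth h2 q s2)
  (A9' : relative_bandwidth l h2 h s2)
  (A10' : root_n_consistent M S alphahat) (q_range : (l <= q < k)%N)
  (D_alphaX : CI M (treat M) (covX M) (alphaX M))
  (D_Xt : CI M (treat M) (covX M) (covXt M))
  (X1_Xt : strict_sub (covX1 M) (covXt M))
  (Xt_X : comps (covXt M) = comps (covX M))
  (X1_alphaX : strict_sub (covX1 M) (alphaX M))
  (x10 : 'rV[R]_l) (x10_Omega : Omega M x10)
  (* versions of the conditional expectations defining m_{j,tau} *)
  (eX : bool -> 'rV[R]_k -> R) (ea : bool -> 'rV[R]_q -> R)
  (eXE : forall j, condE M (check_score M tau x10 j) (covX M) (eX j))
  (eaE : forall j, condE M (check_score M tau x10 j) (alphaX M) (ea j)) :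
  let mX j x := eX j x / fq M tau x10 j in
  let ma j v := ea j v / fq M tau x10 j in
  let Dm j t := mX j (covX M t) - ma j (alphaX M t) in
  let pt t := pa (alphaX M t) in
  let gap t :=
    pt t * (1 - pt t) * (Dm true t / pt t + Dm false t / (1 - pt t)) ^+ 2 in
  let sigma2_ncqte := sigma2 M tau x10 p (covX M) p mX in
  let sigma2_scqte := sigma2 M tau x10 p (alphaX M) pa ma in
  sigma2_scqte = (sigma2_ncqte + 'E_(condP M x10)[gap])%E.
Proof.
move=> mX ma Dm pt gap sigma2_ncqte sigma2_scqte.
rewrite /sigma2_scqte /sigma2_ncqte !sigma2_influence; set Q := condP M x10.
have X1_ae := covX1_condP M_ok x10_Omega.
have [[mcovX mpotY mtreat] _ _ _ _] := M_ok.
have malphaX : measurable_fun [set: T] (alphaX M).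
  exact: measurableT_comp (measurable_mulmxr (alpha M)) mcovX.
have := pE.2 x10 x10_Omega; rewrite -/Q => pEQ.
have := paE.2 x10 x10_Omega; rewrite -/Q => paEQ.
have eXQ j := (eXE j).2 x10 x10_Omega; have eaQ j := (eaE j).2 x10 x10_Omega.
have [c c0 [_ /(_ x10 x10_Omega) p_bd]] := A1ii.
have YDX := A1i.2 x10 x10_Omega; have DXa := D_alphaX.2 x10 x10_Omega.
pose f j := fq M tau x10 j.
pose sc j t := check_score M tau x10 j t.
(* The gradient term of the line vanishes where X_1 = x10, so the score becomes
   the indicator of an event in (Y(0), Y(1)). *)
have sc_ae j : \forall t \ae Q, sc j t =
    \1_((fun t => (potY M false t, potY M true t)) @^-1`
        [set y | (if j then y.2 else y.1) <= qtl M j tau x10]) t - tau.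
  apply: filterS X1_ae => t X1t; rewrite /sc /check_score /qtilde X1t big1; last first.
    by move=> i _; rewrite subrr mulr0.
  rewrite addr0 indicE; congr ((nat_of_bool _)%:R - _).
  by apply/idP/idP; rewrite inE /=; case: (j).
have sc_le1 j t : `|sc j t| <= 1.
  rewrite /sc /check_score; case/andP: tau01 => t0 t1.
  by rewrite ler_norml; case: (potY M j t <= _) => /=; lra.
have scb j : ess_bounded Q id (sc j).
  have [_ /measurable_int/measurable_EFinP ms _ _] := eXQ j.
  by split=> //; exists 1; exact: nearW.
have eXb j := cond_exp_ess_bounded mcovX (sc_le1 j) (eXQ j).
have eab j := cond_exp_ess_bounded malphaX (sc_le1 j) (eaQ j).
have Dr1 t : `|Dr M t| <= 1 by rewrite /Dr; case: treat; rewrite ?normr1 ?normr0.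
have Db : ess_bounded Q id (Dr M).
  have [_ /measurable_int/measurable_EFinP mD _ _] := pEQ.
  by split=> //; exists 1; exact: nearW.
have [mp _ _ _] := pEQ; have [mpa _ _ _] := paEQ.
have mpaX : measurable_fun [set: 'rV[R]_k] (fun x => pa (x *m alpha M)).
  exact: measurableT_comp (measurable_mulmxr (alpha M)).
have DrE : Dr M = \1_(treat M @^-1` [set true]) by rewrite indic_treated.
have p_pa : \forall t \ae Q, p (covX M t) = pa (covX M t *m alpha M).
  apply: (centered_unique mcovX mp mpaX (cond_exp_centered mcovX pEQ)).
  rewrite DrE in paEQ *.
  exact: (cond_indep_sufficient mtreat mcovX malphaX measurable_true DXa paEQ).
apply: (@variance_decomposition _ _ _ _ _ Q (covX M) mcovX (treat M)
  (fun j t => sc j t / f j) p (fun x => pa (x *m alpha M)) mX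
  (fun j x => ma j (x *m alpha M)) c) => //.
- by move=> j; apply: ess_boundedM; [exact: scb|exact: ess_bounded_cst].
- by move=> j; apply: ess_boundedM; [exact: eXb|exact: ess_bounded_cst].
- move=> j; apply: ess_boundedM; last exact: ess_bounded_cst.
  have [mea eaC] := eab j; split=> //.
  exact: measurableT_comp (measurable_mulmxr (alpha M)).
- exact: cond_exp_centered.
- move=> j; have := centeredZ mcovX (f j)^-1 (cond_exp_centered mcovX (eXQ j)).
  by congr centered; apply/funext => t; rewrite mulrC mulrBl.
- move=> j; have mY : measurable_fun [set: T] (fun t => (potY M false t, potY M true t)).
    exact: measurable_fun_pair.
  have mA : measurable [set y : R * R | (if j then y.2 else y.1) <= qtl M j tau x10].
    rewrite -[X in measurable X]setTI.
    by case: (j); [apply: (measurable_fun_ler (f := snd) (g := cst _))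
                  |apply: (measurable_fun_ler (f := fst) (g := cst _))].
  have := centered_score_treat mY mtreat mcovX mA YDX (sc_ae j) (eXQ j) pEQ.
  move=> /(centeredZ mcovX (f j)^-1); congr centered; apply/funext => t.
  by rewrite mulrC mulrBl !mulrA.
Qed.
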